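(* Let $\Gamma$ be a torsion-free commutative cancellative monoid such that $\Gamma\cap-\Gamma=\{0\}$ (i.e. its group of units is trivial). Let $R$ be a $\Gamma$-graded domain with $0$th graded component $R_0$. Suppose that every flat graded overring of $R$ is a localization of $R$. Then every flat overring of $R_0$ is a localization of $R_0$.
   Context: The monoid $\Gamma$ is written additively, and $\langle\Gamma\rangle=\{a-b\mid a,b\in\Gamma\}$ is its group of differences. A $\Gamma$-graded domain is an integral domain $R=\bigoplus_{\alpha\in\Gamma}R_\alpha$ with each $R_\alpha$ an additive subgroup and $R_\beta R_\gamma\subseteq R_{\beta+\gamma}$. Its graded quotient field is $R_H$, where $H$ is the set of nonzero homogeneous elements of $R$; it is $\langle\Gamma\rangle$-graded with $f/g$ (for $f,g$ homogeneous, $g\neq0$) of degree $\deg f-\deg g$. A graded overring of $R$ is a graded subring of $R_H$ containing $R$. An overring of an integral domain $A$ is a ring between $A$ and its quotient field. An overring is flat if it is flat as a module over the base domain. A localization of a domain $A$ is a ring $A_W$ with $W$ a multiplicative subset of $A$. *)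

(* Defs.v *)
From HB Require Import structures.
From mathcomp Require Import all_boot all_order all_algebra.
From mathcomp Require Import boolp classical_sets.

Set Implicit Arguments.
Unset Strict Implicit.
Unset Printing Implicit Defensive.

Import GRing.Theory.

Local Open Scope classical_set_scope.
Local Open Scope ring_scope.
Local Open Scope quotient_scope.

(* x%:F is the image of x : R in the quotient field {fraction R} *)
Notation "x %:F" := (@FracField.tofrac _ x) : ring_scope.

Definition cancellative (G : nmodType) : Prop :=
  forall a b c : G, a + b = a + c -> b = c.

Definition torsion_free (G : nmodType) : Prop :=
  forall (n : nat) (a b : G), (0 < n)%N -> a *+ n = b *+ n -> a = b.

Definition trivial_units (G : nmodType) : Prop :=
  forall a b : G, a + b = 0 -> a = 0.

Section DiffGroup.
Variable G : nmodType.
Implicit Types p q r : G * G.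

(* The pair (a, b) stands for a - b. The extra summand e makes the relation
   transitive without cancellativity, so that the group of differences exists
   for every nmodType; it can be dropped when G is cancellative. *)
Definition diff_eq p q : bool :=
  `[< exists e : G, p.1 + q.2 + e = q.1 + p.2 + e >].

Fact diff_eq_refl : reflexive diff_eq.
Proof. by move=> p; apply/asboolP; exists 0. Qed.

Fact diff_eq_sym : symmetric diff_eq.
Proof. by move=> p q; apply/asboolP/asboolP => -[e H]; exists e. Qed.

Fact diff_eq_trans : transitive diff_eq.
Proof.
move=> q p r /asboolP[e He] /asboolP[f Hf]; apply/asboolP.
exists (q.1 + q.2 + e + f).
transitivity ((p.1 + q.2 + e) + (q.1 + r.2 + f)).
  by rewrite (AC (2*4) ((1*4*5)*(3*2*6))%AC).
by rewrite He Hf (AC (3*3) ((4*2)*(1*5*3*6))%AC).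
Qed.

Canonical diff_equiv :=
  EquivRel diff_eq diff_eq_refl diff_eq_sym diff_eq_trans.

Definition diff_group : Type := {eq_quot diff_eq}.
HB.instance Definition _ := Choice.on diff_group.
HB.instance Definition _ := EqQuotient.on diff_group.

Definition diff (a b : G) : diff_group := \pi_diff_group (a, b).

Lemma diff_group_eqP (a b c d : G) :
  diff a b = diff c d <-> exists e : G, a + d + e = c + b + e.
Proof.
split=> [/eqmodP/asboolP //|H].
by apply/eqmodP/asboolP.
Qed.

Lemma diff_group_ind (P : diff_group -> Prop) :
  (forall a b, P (diff a b)) -> forall d, P d.
Proof. by move=> H d; rewrite -[d]reprK; case: (repr d). Qed.

Definition diff_add (x y : diff_group) : diff_group :=
  diff ((repr x).1 + (repr y).1) ((repr x).2 + (repr y).2).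
Definition diff_opp (x : diff_group) : diff_group :=
  diff (repr x).2 (repr x).1.

Fact diff_repr a b :
  exists e : G, (repr (diff a b)).1 + b + e = a + (repr (diff a b)).2 + e.
Proof.
by apply/diff_group_eqP; rewrite /diff -surjective_pairing reprK.
Qed.

Fact diff_addE a b c d : diff_add (diff a b) (diff c d) = diff (a + c) (b + d).
Proof.
have [e He] := diff_repr a b; have [f Hf] := diff_repr c d.
apply/diff_group_eqP; exists (e + f).
case: (repr (diff a b)) (repr (diff c d)) He Hf => [p1 p2] [q1 q2] /= He Hf.
transitivity ((p1 + b + e) + (q1 + d + f)).
  by rewrite (AC (2*2*2) ((1*3*5)*(2*4*6))%AC).
by rewrite He Hf (AC (3*3) ((1*4)*(2*5)*(3*6))%AC).
Qed.

Fact diff_oppE a b : diff_opp (diff a b) = diff b a.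
Proof.
have [e He] := diff_repr a b; apply/diff_group_eqP; exists e.
by rewrite /= (addrC (repr _).2) -He (addrC b).
Qed.

Fact diff_addA : associative diff_add.
Proof.
elim/diff_group_ind=> a b; elim/diff_group_ind=> c d.
by elim/diff_group_ind=> e f; rewrite !diff_addE !addrA.
Qed.

Fact diff_addC : commutative diff_add.
Proof.
elim/diff_group_ind=> a b; elim/diff_group_ind=> c d.
by rewrite !diff_addE addrC (addrC b).
Qed.

Fact diff_add0 : left_id (diff 0 0) diff_add.
Proof. by elim/diff_group_ind=> a b; rewrite diff_addE !add0r. Qed.

Fact diff_addN : left_inverse (diff 0 0) diff_opp diff_add.
Proof.
elim/diff_group_ind=> a b; rewrite diff_oppE diff_addE.
by apply/diff_group_eqP; exists 0; rewrite !addr0 add0r addrC.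
Qed.

HB.instance Definition _ := GRing.isZmodule.Build diff_group
  diff_addA diff_addC diff_add0 diff_addN.

End DiffGroup.

Section Tensor.
Variables (A : comNzRingType) (M N : lmodType A).

(* A list [:: (m1, n1); ..; (mk, nk)] stands for the sum of the mi (x) ni.
   Signs are not needed in formal sums since - (m (x) n) is (- m) (x) n. *)
Inductive tensor_cong : seq (M * N) -> seq (M * N) -> Prop :=
| tensor_refl s : tensor_cong s s
| tensor_sym s t : tensor_cong s t -> tensor_cong t s
| tensor_trans s t u : tensor_cong s t -> tensor_cong t u -> tensor_cong s u
| tensor_cat s s' t t' :
    tensor_cong s s' -> tensor_cong t t' -> tensor_cong (s ++ t) (s' ++ t')
| tensor_catC s t : tensor_cong (s ++ t) (t ++ s)
| tensor_0l n : tensor_cong [:: (0, n)] [::]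
| tensor_Dl m m' n : tensor_cong [:: (m + m', n)] [:: (m, n); (m', n)]
| tensor_Dr m n n' : tensor_cong [:: (m, n + n')] [:: (m, n); (m, n')]
| tensor_Z a m n : tensor_cong [:: (a *: m, n)] [:: (m, a *: n)].

Definition tensor_eq (s t : seq (M * N)) : bool := `[< tensor_cong s t >].

Fact tensor_eq_refl : reflexive tensor_eq.
Proof. by move=> s; apply/asboolP; apply: tensor_refl. Qed.

Fact tensor_eq_sym : symmetric tensor_eq.
Proof. by move=> s t; apply/asboolP/asboolP; apply: tensor_sym. Qed.

Fact tensor_eq_trans : transitive tensor_eq.
Proof.
move=> t s u /asboolP st /asboolP tu.
by apply/asboolP; apply: tensor_trans st tu.
Qed.

Canonical tensor_equiv :=
  EquivRel tensor_eq tensor_eq_refl tensor_eq_sym tensor_eq_trans.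

Definition tensor : Type := {eq_quot tensor_eq}.
HB.instance Definition _ := Choice.on tensor.
HB.instance Definition _ := EqQuotient.on tensor.

Definition tensor_class (s : seq (M * N)) : tensor := \pi_tensor s.

Lemma tensor_classP s t : tensor_class s = tensor_class t <-> tensor_cong s t.
Proof.
split=> [/eqmodP/asboolP //|H].
by apply/eqmodP/asboolP.
Qed.

Lemma tensor_reprK (x : tensor) : tensor_class (repr x) = x.
Proof. exact: reprK. Qed.

Lemma tensor_ind (P : tensor -> Prop) :
  (forall s, P (tensor_class s)) -> forall x, P x.
Proof. by move=> H x; rewrite -[x]reprK; apply: H. Qed.

Lemma tensor_repr s : tensor_cong (repr (tensor_class s)) s.
Proof. by apply/tensor_classP; rewrite /tensor_class reprK. Qed.

Definition tensor_add (x y : tensor) : tensor :=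
  tensor_class (repr x ++ repr y).
Definition tensor_opp (x : tensor) : tensor :=
  tensor_class [seq (- p.1, p.2) | p <- repr x].

Fact tensor_addE s t :
  tensor_add (tensor_class s) (tensor_class t) = tensor_class (s ++ t).
Proof. by apply/tensor_classP/tensor_cat; apply: tensor_repr. Qed.

Fact tensor_addA : associative tensor_add.
Proof.
by do 3![elim/tensor_ind=> ?]; rewrite !tensor_addE catA.
Qed.

Fact tensor_addC : commutative tensor_add.
Proof.
elim/tensor_ind=> s; elim/tensor_ind=> t; rewrite !tensor_addE.
by apply/tensor_classP/tensor_catC.
Qed.

Fact tensor_add0 : left_id (tensor_class [::]) tensor_add.
Proof. by elim/tensor_ind=> s; rewrite tensor_addE. Qed.

Fact tensor_addN : left_inverse (tensor_class [::]) tensor_opp tensor_add.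
Proof.
move=> x; rewrite -{2}[x]reprK tensor_addE; apply/tensor_classP.
elim: (repr x) => [|[m n] s IH]; first exact: tensor_refl.
rewrite /= -(cat1s (- m, n)) -(cat1s (m, n) s).
set s' := [seq _ | _ <- s] in IH *.
apply: (@tensor_trans _ (([:: (- m, n)] ++ [:: (m, n)]) ++ (s' ++ s))).
  rewrite -!catA; apply: tensor_cat; first exact: tensor_refl.
  by rewrite !catA; apply: tensor_cat;
    [exact: tensor_catC | exact: tensor_refl].
rewrite -[X in tensor_cong _ X]cats0; apply: tensor_cat IH.
apply: tensor_trans (tensor_0l n).
by rewrite -(addNr m); apply/tensor_sym/tensor_Dl.
Qed.

HB.instance Definition _ := GRing.isZmodule.Build tensor
  tensor_addA tensor_addC tensor_add0 tensor_addN.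

(* the universal property of the tensor product *)
Lemma tensor_lift (P : zmodType) (b : M -> N -> P) :
    (forall m m' n, b (m + m') n = b m n + b m' n) ->
    (forall m n n', b m (n + n') = b m n + b m n') ->
    (forall a m n, b (a *: m) n = b m (a *: n)) ->
  exists! g : tensor -> P,
    zmod_morphism g /\ forall m n, g (tensor_class [:: (m, n)]) = b m n.
Proof.
move=> bDl bDr bZ; pose F (s : seq (M * N)) := \sum_(p <- s) b p.1 p.2.
have FE s t : tensor_cong s t -> F s = F t.
  elim=> //= {s t}.
  - by move=> s t u _ -> _ ->.
  - by move=> s s' t t' _ Fs _ Ft; rewrite /F !big_cat; congr (_ + _).
  - by move=> s t; rewrite /F !big_cat /= addrC.
  - move=> n; rewrite /F big_seq1 big_nil /=.
    by apply: (addrI (b 0 n)); rewrite -bDl !addr0.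
  - by move=> m m' n; rewrite /F big_seq1 !big_cons big_nil addr0 bDl.
  - by move=> m n n'; rewrite /F big_seq1 !big_cons big_nil addr0 bDr.
  - by move=> a m n; rewrite /F !big_seq1 bZ.
have addE s t : tensor_class s + tensor_class t = tensor_class (s ++ t).
  exact: tensor_addE.
have gE s : F (repr (tensor_class s)) = F s by apply/FE/tensor_repr.
have FD (x y : tensor) : F (repr (x + y)) = F (repr x) + F (repr y).
  rewrite -(tensor_reprK x) -(tensor_reprK y); move: (repr x) (repr y) => s t.
  by rewrite addE !gE /F big_cat.
exists (fun x : tensor => F (repr x)); split.
  split=> [x y|m n]; last by rewrite gE /F big_seq1.
  by apply: (addIr (F (repr y))); rewrite -FD !subrK.
move=> g [gB gb]; apply/funext => x.
rewrite -(tensor_reprK x); move: (repr x) => s; rewrite gE.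
have g0 : g 0 = 0 by move: (gB 0 0); rewrite !subrr.
have gD y z : g (y + z) = g y + g z.
  by rewrite -{1}[z]opprK -[- z]sub0r !gB g0 sub0r opprK.
elim: s => [|[m n] s IH]; first by rewrite /F big_nil; exact/esym/g0.
by rewrite /F big_cons -cat1s -addE gD gb -IH.
Qed.

End Tensor.

Definition tensor_map (A : comNzRingType) (M N N' : lmodType A)
    (f : {linear N -> N'}) (x : tensor M N) : tensor M N' :=
  tensor_class [seq (p.1, f p.2) | p <- repr x].

Lemma tensor_mapE (A : comNzRingType) (M N N' : lmodType A)
    (f : {linear N -> N'}) (s : seq (M * N)) :
  tensor_map f (tensor_class s) = tensor_class [seq (p.1, f p.2) | p <- s].
Proof.
suff H (t u : seq (M * N)) : tensor_cong t u -> tensor_cong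
    [seq (p.1, f p.2) | p <- t] [seq (p.1, f p.2) | p <- u].
  by apply/tensor_classP/H/tensor_repr.
elim=> {t u} /=.
- by move=> t; apply: tensor_refl.
- by move=> t u _; apply: tensor_sym.
- by move=> t u v _ H _; apply: tensor_trans H.
- by move=> t t' u u' _ Ht _ Hu; rewrite !map_cat; apply: tensor_cat.
- by move=> t u; rewrite !map_cat; apply: tensor_catC.
- by move=> n; apply: tensor_0l.
- by move=> m m' n; apply: tensor_Dl.
- by move=> m n n'; rewrite linearD; apply: tensor_Dr.
- by move=> a m n; rewrite linearZ; apply: tensor_Z.
Qed.

Definition flat (A : comNzRingType) (M : lmodType A) : Prop :=
  forall (N N' : lmodType A) (f : {linear N -> N'}),
    injective f -> injective (tensor_map (M := M) f).

Section SubringType.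
Variables (K : fieldType) (A : subringClosed K).

Definition subring_type : Type := {x : K | x \in A}.
HB.instance Definition _ := SubChoice.on subring_type.
HB.instance Definition _ := [SubChoice_isSubComNzRing of subring_type by <:].

End SubringType.

Section RestrictScalars.
Variables (K : fieldType) (A B : subringClosed K).

(* B as a module over its subring A *)
Definition overring_module of {subset A <= B} : Type := subring_type B.

Variable sAB : {subset A <= B}.
Local Notation BA := (overring_module sAB).

HB.instance Definition _ := GRing.Zmodule.copy BA (subring_type B).

Definition overring_scale (a : subring_type A) (x : BA) : BA :=
  (Sub (val a) (sAB (valP a)) : subring_type B) * (x : subring_type B).

Fact overring_scaleA a b x :
  overring_scale a (overring_scale b x) = overring_scale (a * b) x.
Proof. by apply: val_inj; rewrite /= mulrA. Qed.

Fact overring_scale1 : left_id 1 overring_scale.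
Proof. by move=> x; apply: val_inj; rewrite /= mul1r. Qed.

Fact overring_scaleDr : right_distributive overring_scale +%R.
Proof. by move=> a x y; apply: val_inj; rewrite /= mulrDr. Qed.

Fact overring_scaleDl x : {morph overring_scale^~ x : a b / a + b}.
Proof. by move=> a b; apply: val_inj; rewrite /= mulrDl. Qed.

HB.instance Definition _ :=
  GRing.Zmodule_isLmodule.Build (subring_type A) BA
    overring_scaleA overring_scale1 overring_scaleDr overring_scaleDl.

End RestrictScalars.

(* Domains are taken as subrings of an ambient field K; the quotient field of
   such an A is then the subfield of K made of the fractions of elements of A. *)
Section Overrings.
Variables (K : fieldType) (A : subringClosed K).

Definition quotient_field : set K :=
  [set x | exists a b : K, [/\ a \in A, b \in A, b != 0 & x = a / b]].

Definition overring (B : subringClosed K) : Prop :=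
  {subset A <= B} /\ forall x : K, x \in B -> quotient_field x.

Definition flat_over (B : subringClosed K) : Prop :=
  exists sAB : {subset A <= B}, flat (overring_module sAB).

Definition multiplicative (W : set K) : Prop :=
  [/\ forall w : K, W w -> w \in A, W 1, ~ W 0 &
      forall v w : K, W v -> W w -> W (v * w)].

Definition localization (B : subringClosed K) : Prop :=
  exists2 W : set K, multiplicative W &
    forall x : K,
      x \in B <-> exists a w : K, [/\ a \in A, W w & x = a / w].

End Overrings.

(* The subset S of A is the internal direct sum of the additive subgroups S_ g,
   and S_ g * S_ h is contained in S_ (g + h). *)
Record is_grading (G : nmodType) (A : nzRingType) (S : set A) (S_ : G -> set A) :
    Prop := IsGrading {
  grading_sub : forall g x, S_ g x -> S x;
  grading_0 : forall g, S_ g 0;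
  grading_B : forall g x y, S_ g x -> S_ g y -> S_ g (x - y);
  grading_sum : forall x, S x -> exists (s : seq G) (c : G -> A),
    [/\ uniq s, forall g, g \in s -> S_ g (c g) & x = \sum_(g <- s) c g];
  grading_direct : forall (s : seq G) (c : G -> A),
    uniq s -> (forall g, g \in s -> S_ g (c g)) ->
    \sum_(g <- s) c g = 0 -> forall g, g \in s -> c g = 0;
  grading_mul : forall g h x y, S_ g x -> S_ h y -> S_ (g + h) (x * y)
}.

Lemma grading_1 (G : nmodType) (R : nzRingType) (R_ : G -> set R) :
  cancellative G -> is_grading setT R_ -> R_ 0 1.
Proof.
move=> cG grR; have [s [e [us es E1]]] := grading_sum grR (x := 1) I.
pose e0 := if 0 \in s then e 0 else 0.
have Re0 : R_ 0 e0.
  by rewrite /e0; case: ifP => [/es //|_]; apply: grading_0 grR _.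
have xe0 g x : R_ g x -> x * e0 = x.
  move=> Rx; pose t := [seq g + i | i <- rem 0 s].
  have inj_g : injective (+%R g) by move=> i j; apply: cG.
  have xE : x = x * e0 + \sum_(i <- rem 0 s) x * e i.
    rewrite -{1}[x]mulr1 E1 mulr_sumr /e0; case: ifPn => s0.
      by rewrite (perm_big _ (perm_to_rem s0)) big_cons.
    by rewrite rem_id // mulr0 add0r.
  pose c k := if k == g then x * e0 - x
              else if [pick i : seq_sub (rem 0 s) | g + val i == k] is Some i
              then x * e (val i) else 0.
  have cE i : i \in rem 0 s -> c (g + i) = x * e i.
    move=> si; rewrite /c -{2}[g]addr0 (inj_eq inj_g).
    have -> : (i == 0) = false.
      by apply: contraTF si => /eqP->; rewrite mem_rem_uniqF.
    case: pickP => [j /eqP/inj_g -> //|/(_ (SeqSub si))].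
    by rewrite /= eqxx.
  suff /eqP : x * e0 - x = 0 by rewrite subr_eq0 => /eqP.
  have -> : x * e0 - x = c g by rewrite /c eqxx.
  apply: (grading_direct grR (s := g :: t)); last exact: mem_head.
  - rewrite /= map_inj_uniq // rem_uniq // andbT.
    apply/negP => /mapP[i si /eqP]; rewrite -{1}[g]addr0 (inj_eq inj_g).
    by move=> /eqP i0; rewrite -i0 mem_rem_uniqF in si.
  - move=> k; rewrite inE => /predU1P[->|/mapP[i si ->]].
      rewrite /c eqxx; apply: (grading_B grR) => //.
      by rewrite -[g]addr0; apply: (grading_mul grR).
    by rewrite cE //; apply: (grading_mul grR) => //; exact/es/(mem_rem si).
  rewrite big_cons big_map (eq_big_seq _ cE) /c eqxx.
  by rewrite addrAC -xE subrr.
rewrite -[X in R_ 0 X](_ : e0 = 1) //.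
rewrite -[e0]mul1r {1}E1 mulr_suml E1; apply: eq_big_seq => g /es.
exact: xe0.
Qed.

Section GradedDomain.
Variables (G : nmodType) (R : idomainType) (R_ : G -> set R).

(* R and its component of degree 0, as subsets of {fraction R} *)
Definition domain_pred : {pred {fraction R}} :=
  fun x => `[< exists r : R, x = r%:F >].

Definition deg0_pred of cancellative G & is_grading setT R_ :
    {pred {fraction R}} :=
  fun x => `[< exists2 r : R, R_ 0 r & x = r%:F >].

Fact domain_subring_closed : subring_closed domain_pred.
Proof.
split=> [|x y|x y]; first by apply/asboolP; exists 1; rewrite rmorph1.
- move=> /asboolP[r ->] /asboolP[s ->].
  by apply/asboolP; exists (r - s); rewrite rmorphB.
- move=> /asboolP[r ->] /asboolP[s ->].
  by apply/asboolP; exists (r * s); rewrite rmorphM.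
Qed.

HB.instance Definition _ :=
  GRing.isSubringClosed.Build {fraction R} domain_pred domain_subring_closed.

Fact deg0_subring_closed cG grR : subring_closed (@deg0_pred cG grR).
Proof.
split=> [|x y|x y].
- by apply/asboolP; exists 1; rewrite ?rmorph1 //; apply: grading_1.
- move=> /asboolP[r Rr ->] /asboolP[s Rs ->]; apply/asboolP.
  by exists (r - s); rewrite ?rmorphB //; apply: (grading_B grR).
- move=> /asboolP[r Rr ->] /asboolP[s Rs ->]; apply/asboolP.
  exists (r * s); rewrite ?rmorphM // -[0]addr0.
  exact: (grading_mul grR).
Qed.

HB.instance Definition _ cG grR :=
  GRing.isSubringClosed.Build {fraction R} (@deg0_pred cG grR)
    (deg0_subring_closed cG grR).

Definition domain : subringClosed {fraction R} := domain_pred.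

Definition deg0 (cG : cancellative G) (grR : is_grading setT R_) :
  subringClosed {fraction R} := deg0_pred cG grR.

Definition homogeneous (r : R) : Prop := exists g : G, R_ g r.

Definition graded_quotient_field : set {fraction R} :=
  [set x | exists r h : R, [/\ homogeneous h, h != 0 & x = r%:F / h%:F]].

(* 0 is added explicitly because f / g with f = 0 does not reach all degrees:
   b has to be the degree of some nonzero g. *)
Definition graded_quotient_field_component (d : diff_group G) :
    set {fraction R} :=
  [set x | x = 0 \/ exists (a b : G) (f g : R),
     [/\ R_ a f, R_ b g, g != 0, x = f%:F / g%:F & d = diff a b]].

Definition graded_overring (T : subringClosed {fraction R}) : Prop :=
  [/\ {subset domain <= T},
      forall x, x \in T -> graded_quotient_field x &
      is_grading [set x | x \in T]
        (fun d => [set x | x \in T] `&` graded_quotient_field_component d)].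

End GradedDomain.

(* Main.v *)
From HB Require Import structures.
Require Import Defs.
From mathcomp Require Import all_boot all_order all_algebra.
From mathcomp Require Import ring.
From mathcomp Require Import boolp classical_sets.

(** Let A be the component of degree 0 of R and B a flat overring of A. The
subring T = B R of the fraction field of R is a graded overring of R whose
component of degree g is B R_g; in particular its component of degree 0 is
B A = B. If T is known to be flat over R, then T is a localization of R at some
multiplicative set W, and it remains to see that B is the localization of A at
the same W.

Flatness passes from B to T because it is a condition on denominators: an
overring B of A is flat if and only if, for every b in B, the ideal
(A : b) = {a in A | a b in A} satisfies (A : b) B = B (both directions are
needed: [flat_extends_denominators] over A, [denominators_flat] over R). An
element of T is a finite sum of products b r with b in B and r in R, so its
denominator ideal in R contains a finite product of ideals (A : b), and the
condition holds for T over R ([extension_denominators]).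

For the descent from W ([localization_deg0_of_extension]), every element of W is
a unit of T. The monoid G of degrees is torsion-free and cancellative, so it
carries an order that is compatible with the addition and total on any given
finite part ([positive_order_total_on]); since 0 is the only unit of G, the order
may moreover be chosen so that 0 is the least element. If x y = 1
in T, the top degrees of x and y then add up to 0, so both are 0, and x has no
component in another degree ([unit_degree0]). Hence W and the inverses of its
elements lie in B. Finally, the elements of R lying in B are those of A
([domain_overring_deg0]), so W is contained in A, and b = r / w in B with r in R
and w in W forces r = b w to lie in A. *)

Set Implicit Arguments.
Unset Strict Implicit.
Unset Printing Implicit Defensive.

Import GRing.Theory.

Local Open Scope classical_set_scope.
Local Open Scope ring_scope.

(** * Compatible orders on a torsion-free monoid *)
Record positive_order (G : nmodType) (le : G -> G -> Prop) : Prop :=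
  PositiveOrder {
  po_trans : forall a b c, le a b -> le b c -> le a c;
  po_anti : forall a b, le a b -> le b a -> a = b;
  po_add2r : forall a b c, le (a + c) (b + c) <-> le a b;
  po_ge0 : forall a, le 0 a
}.

Section PositiveOrder.
Variable G : nmodType.
Implicit Type le : G -> G -> Prop.

Lemma po_refl le : positive_order le -> forall a, le a a.
Proof.
by move=> po a; have /(po_add2r po _ _ a) := po_ge0 po 0; rewrite add0r.
Qed.

Lemma po_add le : positive_order le ->
  forall a b c d, le a b -> le c d -> le (a + c) (b + d).
Proof.
move=> po a b c d ab cd; apply: (po_trans po (b := b + c)).
  exact/(po_add2r po).
by rewrite addrC [b + d]addrC; apply/(po_add2r po).
Qed.

Lemma po_muln le : positive_order le ->
  forall a b n, le a b -> le (a *+ n) (b *+ n).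
Proof.
move=> po a b n ab; elim: n => [|n IH]; first exact: po_refl.
by rewrite !mulrS; apply: po_add.
Qed.

(** The order to start from: antisymmetry is where the triviality of the group
of units enters. *)
Lemma divisibility_positive_order :
  cancellative G -> trivial_units G ->
  positive_order (fun a b : G => exists c, b = a + c).
Proof.
move=> cG uG; split.
- by move=> a _ _ [c ->] [d ->]; exists (c + d); rewrite addrA.
- move=> a _ [c ->] [d E].
  have /esym/uG -> : 0 = c + d by apply: (cG a); rewrite addr0 addrA.
  by rewrite addr0.
- move=> a b c; split=> -[d E]; exists d; last by rewrite E addrAC.
  by apply: (cG c); rewrite addrC E addrAC addrC.
- by move=> a; exists a; rewrite add0r.
Qed.

(** The smallest compatible order containing [le] and x <= y puts a below b when
b - a is a nonnegative element plus n (y - x) for some n. It is antisymmetric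
unless x != y and some positive multiple of x - y is nonnegative. *)
Lemma positive_order_extend_le le x y : positive_order le ->
    (forall k, (0 < k)%N -> le (y *+ k) (x *+ k) -> x = y) ->
  exists2 le', positive_order le' & (forall a b, le a b -> le' a b) /\ le' x y.
Proof.
move=> po xy.
exists (fun a b => exists n, le (a + y *+ n) (b + x *+ n)); last first.
  split=> [a b ab|]; first by exists 0%N; rewrite !mulr0n !addr0.
  by exists 1%N; rewrite !mulr1n addrC; apply: po_refl.
split.
- move=> a b c [n ab] [m bc]; exists (n + m)%N.
  apply/(po_add2r po _ _ b); move: (po_add po ab bc).
  by rewrite !mulrnDr (AC (2*2) (1*(2*4)*3))%AC [X in le _ X](AC (2*2) (3*(2*4)*1))%AC.
- move=> a b [n ab] [m ba].
  have [nm0|nm_gt0] := posnP (n + m).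
    move/eqP: nm0 ab ba; rewrite addn_eq0 => /andP[/eqP-> /eqP->].
    by rewrite !mulr0n !addr0; apply: (po_anti po).
  have {}xy : x = y.
    apply: (xy (n + m)%N nm_gt0); apply/(po_add2r po _ _ (a + b)).
    move: (po_add po ab ba); rewrite !mulrnDr.
    by rewrite (AC (2*2) ((2*4)*(1*3)))%AC [X in le _ X](AC (2*2) ((2*4)*(3*1)))%AC.
  move: ab ba; rewrite xy => /(po_add2r po) ab /(po_add2r po) ba.
  exact: (po_anti po).
- move=> a b c; split=> -[n ab]; exists n.
    by apply/(po_add2r po _ _ c); rewrite addrAC [X in le _ X]addrAC.
  by rewrite addrAC [X in le _ X]addrAC; apply/(po_add2r po).
- by move=> a; exists 0%N; rewrite !mulr0n !addr0; apply: po_ge0.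
Qed.

(** If no positive multiple of x - y is nonnegative, x <= y can be added. If
k (x - y) >= 0 for some k > 0, y <= x can: l (y - x) >= 0 with l > 0 would give
k l x = k l y, hence x = y as there is no torsion. *)
Lemma positive_order_compare le x y : torsion_free G -> positive_order le ->
  exists2 le', positive_order le' &
    (forall a b, le a b -> le' a b) /\ (le' x y \/ le' y x).
Proof.
move=> tG po.
have [[k [k_gt0 yx]]|nyx] :=
    pselect (exists k, (0 < k)%N /\ le (y *+ k) (x *+ k)).
  have [//||le' po' [ll' yx']] := @positive_order_extend_le le y x.
    move=> l l_gt0 xy; apply: (tG (k * l)%N); rewrite ?muln_gt0 ?k_gt0 //.
    apply: (po_anti po); first by rewrite !mulrnA; apply: po_muln.
    by rewrite mulnC !mulrnA; apply: po_muln.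
  by exists le' => //; split=> //; right.
have [//||le' po' [ll' xy']] := @positive_order_extend_le le x y.
  by move=> k k_gt0 yx; case: nyx; exists k.
by exists le' => //; split=> //; left.
Qed.

(** Comparability on a finite set is all that the top degree of a finite sum
needs, and it takes finitely many extensions. *)
Lemma positive_order_total_on (s : seq G) :
    cancellative G -> torsion_free G -> trivial_units G ->
  exists2 le, positive_order le & forall x y, x \in s -> y \in s -> le x y \/ le y x.
Proof.
move=> cG tG uG.
suff [le po le_s] : exists2 le, positive_order le &
    forall p, p \in [seq (x, y) | x <- s, y <- s] -> le p.1 p.2 \/ le p.2 p.1.
  by exists le => // x y sx sy; apply: (le_s (x, y)); apply: allpairs_f.
elim: [seq _ | _ <- _, _ <- _] => [|[x y] l [le po le_l]].
  by eexists; [exact: divisibility_positive_order|].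
have [le' po' [ll' xy]] := positive_order_compare x y tG po.
exists le' => // p; rewrite inE => /predU1P[-> //|/le_l[] /ll'];
  by [left|right].
Qed.

Lemma exists_max_on le (s : seq G) x0 : positive_order le ->
    (forall x y, x \in x0 :: s -> y \in x0 :: s -> le x y \/ le y x) ->
  exists2 m, m \in x0 :: s & forall x, x \in x0 :: s -> le x m.
Proof.
move=> po; elim: s x0 => [|x s IH] x0 tot.
  exists x0; first exact: mem_head.
  by move=> x; rewrite inE => /eqP->; apply: po_refl.
have [y z sy sz|m sm max_m] := IH x; first by apply: tot; rewrite inE ?sy ?sz orbT.
have [|| x0m | mx0] := tot x0 m.
- exact: mem_head.
- by rewrite inE sm orbT.
- exists m; first by rewrite inE sm orbT.
  by move=> y; rewrite inE => /predU1P[->|/max_m].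
- exists x0; first exact: mem_head.
  move=> y; rewrite inE => /predU1P[->|/max_m ym]; first exact: po_refl.
  exact: (po_trans po) mx0.
Qed.
End PositiveOrder.

(** * Graded rings *)
Section Grading.
Variables (G : nmodType) (A : nzRingType) (S : set A) (S_ : G -> set A).
Hypothesis grS : is_grading S S_.

Lemma grading_N g x : S_ g x -> S_ g (- x).
Proof.
by move=> Sx; rewrite -sub0r; apply: (grading_B grS) => //; apply: (grading_0 grS).
Qed.

Lemma grading_D g x y : S_ g x -> S_ g y -> S_ g (x + y).
Proof.
by move=> Sx /grading_N Sy; rewrite -[y]opprK; apply: (grading_B grS).
Qed.

Lemma grading_bigsum (I : eqType) (t : seq I) (P : pred I) g (y : I -> A) :
  (forall i, i \in t -> P i -> S_ g (y i)) -> S_ g (\sum_(i <- t | P i) y i).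
Proof.
move=> Sy; rewrite big_seq_cond; apply: big_ind => [|x z|i /andP[/Sy]//].
- exact: (grading_0 grS).
- exact: grading_D.
Qed.

Lemma regroup_sum (I : eqType) (t : seq I) (d : I -> G) (y : I -> A) :
  \sum_(i <- t) y i =
    \sum_(g <- undup (map d t)) \sum_(i <- t | d i == g) y i.
Proof.
rewrite (exchange_big_dep predT) //=; apply: eq_big_seq => i ti.
rewrite -big_filter (@perm_big _ _ _ _ _ [:: d i]) ?big_seq1 //.
apply: uniq_perm => //; first exact/filter_uniq/undup_uniq.
move=> g; rewrite mem_filter mem_undup inE eq_sym andb_idr // => /eqP->.
exact: map_f.
Qed.

(** Comparison of the coefficients of degree g on both sides of an equality
between a sum of homogeneous elements, with possibly repeated degrees, and a
homogeneous element. *)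
Lemma grading_coef (I : eqType) (t : seq I) (d : I -> G) (y : I -> A) k z :
    (forall i, i \in t -> S_ (d i) (y i)) -> S_ k z -> \sum_(i <- t) y i = z ->
  forall g, \sum_(i <- t | d i == g) y i = if g == k then z else 0.
Proof.
move=> Sy Sz yz g.
(* the index None stands for the summand - z, of degree k *)
pose t' := None :: map Some t.
pose d' o := if o is Some i then d i else k.
pose y' o := if o is Some i then y i else - z.
have Sy' o : o \in t' -> S_ (d' o) (y' o).
  rewrite inE => /predU1P[->|/mapP[i /Sy Si ->]] //=; exact: grading_N.
have y'0 : \sum_(o <- t') y' o = 0 by rewrite big_cons big_map yz addNr.
suff : \sum_(o <- t' | d' o == g) y' o = 0.
  rewrite big_cons big_map /= eq_sym; case: eqP => // _ /eqP.
  by rewrite addrC subr_eq0 => /eqP.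
have [gt'|gt'] := boolP (g \in undup (map d' t')); last first.
  rewrite big_seq_cond big1 // => o /andP[ot' /eqP og].
  by case/negP: gt'; rewrite mem_undup -og map_f.
apply: (grading_direct grS (c := fun g => _)) gt'; first exact: undup_uniq.
  by move=> h _; apply: grading_bigsum => o /Sy' So /eqP <-.
by rewrite -regroup_sum.
Qed.

Lemma grading_support x : S x -> exists (s : seq G) (c : G -> A),
  [/\ uniq s, forall g, g \in s -> S_ g (c g),
      forall g, g \in s -> c g != 0 & x = \sum_(g <- s) c g].
Proof.
move=> /(grading_sum grS)[s [c [us Sc ->]]].
exists [seq g <- s | c g != 0], c; split; first exact: filter_uniq.
- by move=> g; rewrite mem_filter => /andP[_ /Sc].
- by move=> g; rewrite mem_filter => /andP[].
- by rewrite big_filter [RHS]big_mkcond; apply: eq_bigr => g _; case: eqP.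
Qed.
End Grading.

(** In an order with least element 0, the top degrees m of x and n of y have
m + n = 0: the component of degree m + n of x y is the product of the top
components, as (m, n) is the only pair of degrees with this sum, and it is not
zero in a domain. *)
Lemma unit_degree0 (G : nmodType) (A : idomainType) (S : set A)
    (S_ : G -> set A) x y :
    cancellative G -> torsion_free G -> trivial_units G ->
    is_grading S S_ -> S_ 0 1 -> S x -> S y -> x * y = 1 -> S_ 0 x.
Proof.
move=> cG tG uG grS S1 Sx Sy xy1.
have [s [c [us Sc c0 xE]]] := grading_support grS Sx.
have [t [e [ut Se e0 yE]]] := grading_support grS Sy.
have [le po tot] := positive_order_total_on (s ++ t) cG tG uG.
have max_of (u : seq G) (f : G -> A) : {subset u <= s ++ t} ->
    \sum_(g <- u) f g != 0 ->
    exists2 m, m \in u & forall g, g \in u -> le g m.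
  case: u => [|g u] ust; first by rewrite big_nil eqxx.
  by move=> _; apply: exists_max_on => // a b /ust ? /ust; apply: tot.
have [||m sm max_m] := max_of s c.
- by move=> g sg; rewrite mem_cat sg.
- by apply: contra_eq_neq xy1; rewrite -xE => ->; rewrite mul0r eq_sym oner_neq0.
have [||n tn max_n] := max_of t e.
- by move=> g sg; rewrite mem_cat sg orbT.
- by apply: contra_eq_neq xy1; rewrite -yE => ->; rewrite mulr0 eq_sym oner_neq0.
have xyE : \sum_(p <- [seq (g, h) | g <- s, h <- t]) c p.1 * e p.2 = 1.
  rewrite big_allpairs -xy1 xE yE mulr_suml; apply: eq_bigr => g _.
  by rewrite mulr_sumr.
have Sce p : p \in [seq (g, h) | g <- s, h <- t] ->
    S_ (p.1 + p.2) (c p.1 * e p.2).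
  by move=> /allpairsP[[g h] /= [/Sc ? /Se ? ->]]; apply: (grading_mul grS).
have := grading_coef grS Sce S1 xyE (m + n).
rewrite -big_filter (@perm_big _ _ _ _ _ [:: (m, n)]) ?big_seq1 /=; last first.
  apply: uniq_perm => //.
    by apply: filter_uniq; apply: allpairs_uniq => // -[? ?] [].
  move=> [g h]; rewrite mem_filter inE /=.
  apply/andP/eqP => [[/eqP ghmn /allpairsP[[g' h'] /= [sg th [eg eh]]]]|].
    move: eg eh sg th => <- <- {g' h'} sg th.
    have gm : g = m.
      apply: (po_anti po); first exact: max_m.
      apply/(po_add2r po _ _ h); rewrite ghmn [m + _]addrC [m + _]addrC.
      exact/(po_add2r po)/max_n.
    by move: ghmn; rewrite gm => /cG ->.
  by move=> [-> ->]; rewrite eqxx; split=> //; apply: allpairs_f.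
case: eqP => [mn0 _|_ cemn]; last first.
  by have := mulf_neq0 (c0 m sm) (e0 n tn); rewrite cemn eqxx.
have m0 := uG _ _ mn0.
rewrite xE; apply: (grading_bigsum grS) => g sg _.
suff <- : g = 0 by apply: Sc.
by apply: (po_anti po); [rewrite -m0; apply: max_m | apply: (po_ge0 po)].
Qed.

Section HomogeneousSums.
Variables (G : nmodType) (A : nzRingType) (S_ : G -> set A).

Lemma sum_homogeneous_uniq (t : seq (G * A)) :
    (forall g, S_ g 0) -> (forall g x y, S_ g x -> S_ g y -> S_ g (x + y)) ->
    (forall p, p \in t -> S_ p.1 p.2) ->
  exists (s : seq G) (c : G -> A), [/\ uniq s, forall g, g \in s -> S_ g (c g) &
    \sum_(p <- t) p.2 = \sum_(g <- s) c g].
Proof.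
move=> S0 SD St; exists (undup [seq p.1 | p <- t]).
exists (fun g => \sum_(p <- t | p.1 == g) p.2); split.
- exact: undup_uniq.
- move=> g _; rewrite big_seq_cond; apply: big_ind => // [|p]; first exact: SD.
  by case/andP=> /St Sp /eqP <-.
- exact: regroup_sum.
Qed.

(** Independence of the components is inherited from an ambient grading, even
one whose degrees lie in a larger monoid. *)
Lemma is_grading_sub (V : nmodType) (S T : set A) (S'_ : V -> set A)
    (phi : G -> V) : injective phi -> is_grading S S'_ ->
    (forall g, S_ g `<=` S'_ (phi g)) ->
    (forall g, S_ g `<=` T) -> (forall g, S_ g 0) ->
    (forall g x y, S_ g x -> S_ g y -> S_ g (x - y)) ->
    (forall g h x y, S_ g x -> S_ h y -> S_ (g + h) (x * y)) ->
    (forall x, T x -> exists2 t : seq (G * A),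
       forall p, p \in t -> S_ p.1 p.2 & x = \sum_(p <- t) p.2) ->
  is_grading T S_.
Proof.
move=> inj_phi grS SS' ST S0 SB SM Tsum; split=> //.
- move=> x /Tsum[t St ->]; apply: sum_homogeneous_uniq => // g y z Sy Sz.
  by rewrite -[z]opprK -[- z]sub0r; apply: (SB) => //; apply: SB.
- move=> s c us Sc c0 g sg.
  have Sc' h : h \in s -> S'_ (phi h) (c h) by move=> /Sc/SS'.
  have := grading_coef grS Sc' (grading_0 grS 0) c0 (phi g).
  rewrite if_same -big_filter (@perm_big _ _ _ _ _ [:: g]) ?big_seq1 //.
  apply: uniq_perm; rewrite ?filter_uniq // => h.
  by rewrite mem_filter inE inj_eq // andb_idr // => /eqP->.
Qed.
End HomogeneousSums.

(** * The graded quotient field *)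
Section GradedQuotientField.
Variables (G : nmodType) (cG : cancellative G).
Variables (R : idomainType) (R_ : G -> set R) (grR : is_grading setT R_).
Local Notation K := {fraction R}.
Local Notation component := (graded_quotient_field_component R_).

Lemma tofrac_neq0 (r : R) : (r%:F != 0) = (r != 0).
Proof. by rewrite tofrac_eq0. Qed.

Lemma tofrac_inj : injective (@FracField.tofrac R).
Proof. by move=> x y /eqP; rewrite tofrac_eq => /eqP. Qed.

Lemma diff_cancel (a b c d : G) : diff a b = diff c d <-> a + d = c + b.
Proof.
split=> [/diff_group_eqP[e]|E]; last by apply/diff_group_eqP; exists 0; rewrite E.
by rewrite addrC [c + b + e]addrC => /cG.
Qed.

Lemma diffD (a b c d : G) : diff a b + diff c d = diff (a + c) (b + d).
Proof. exact: diff_addE. Qed.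

(** A zero coefficient gives no numerator degree: c d = 0 / h has degree d only
if d + b happens to be in G. *)
Lemma common_denominator (s : seq (diff_group G)) (c : diff_group G -> K) :
    (forall d, d \in s -> component d (c d)) ->
  exists (b : G) (h : R), [/\ R_ b h, h != 0 & forall d, d \in s ->
    c d = 0 \/ exists a f, [/\ R_ a f, c d = f%:F / h%:F & d = diff a b]].
Proof.
elim: s => [|d s IH] cs.
  by exists 0, 1; split=> //; [exact: grading_1 | exact: oner_neq0].
have [|b [h [bh h0 hs]]] := IH; first by move=> e se; apply: cs; rewrite inE se orbT.
have Fh0 : h%:F != 0 by rewrite tofrac_neq0.
have [cd0|[a [b' [f [g [af b'g g0 cdE dE]]]]]] := cs d (mem_head _ _).
  exists b, h; split=> // e; rewrite inE => /predU1P[->|/hs //]; by left.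
have Fg0 : g%:F != 0 by rewrite tofrac_neq0.
exists (b' + b), (g * h); split=> [||e]; rewrite ?mulf_neq0 //.
  exact: (grading_mul grR).
rewrite inE => /predU1P[->|/hs[?|[a' [f' [af' -> ->]]]]]; [right|by left|right].
  exists (a + b), (f * h); split; first exact: (grading_mul grR).
    by rewrite cdE !rmorphM -mulf_div mulfV // mulr1.
  by rewrite dE; apply/diff_cancel; rewrite addrAC addrA.
exists (a' + b'), (f' * g); split; first exact: (grading_mul grR).
  by rewrite !rmorphM [g%:F * _]mulrC -mulf_div mulfV // mulr1.
by apply/diff_cancel; rewrite addrA.
Qed.

Lemma graded_quotient_fieldD x y : graded_quotient_field R_ x ->
  graded_quotient_field R_ y -> graded_quotient_field R_ (x + y).
Proof.
move=> [r [h [[a ah] h0 ->]]] [r' [h' [[a' ah'] h'0 ->]]].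
exists (r * h' + r' * h), (h * h'); split; last first.
- by rewrite rmorphD !rmorphM addf_div // tofrac_neq0.
- exact: mulf_neq0.
- by exists (a + a'); apply: (grading_mul grR).
Qed.

Lemma componentN d x : component d x -> component d (- x).
Proof.
move=> [->|[a [b [f [g [af bg g0 -> ->]]]]]]; first by left; rewrite oppr0.
right; exists a, b, (- f), g; split=> //; first exact: (grading_N grR).
by rewrite rmorphN mulNr.
Qed.

Lemma component_B d x y : component d x -> component d y -> component d (x - y).
Proof.
move=> dx /componentN; move: (- y) => {}y dy.
case: dx dy => [->|[a [b [f [g [af bg g0 -> ->]]]]]]; first by rewrite add0r.
case=> [->|[a' [b' [f' [g' [af' bg' g'0 -> /diff_cancel E]]]]]].
  by rewrite addr0; right; exists a, b, f, g.
right; exists (a + b'), (b + b'), (f * g' + f' * g), (g * g'); split.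
- apply: (grading_D grR); first exact: (grading_mul grR).
  by rewrite E; apply: (grading_mul grR).
- exact: (grading_mul grR).
- exact: mulf_neq0.
- by rewrite rmorphD !rmorphM addf_div // tofrac_neq0.
- by apply/diff_cancel; rewrite addrA addrAC.
Qed.

Lemma component_mul d e x y :
  component d x -> component e y -> component (d + e) (x * y).
Proof.
move=> [->|[a [b [f [g [af bg g0 -> ->]]]]]]; first by left; rewrite mul0r.
move=> [->|[a' [b' [f' [g' [af' bg' g'0 -> ->]]]]]]; first by left; rewrite mulr0.
right; exists (a + a'), (b + b'), (f * f'), (g * g'); split; rewrite ?diffD //.
- exact: (grading_mul grR).
- exact: (grading_mul grR).
- exact: mulf_neq0.
- by rewrite !rmorphM mulf_div.
Qed.

(** After multiplication by a homogeneous common denominator of degree b, the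
components of degree diff a b become elements of R of degree a, and distinct
degrees stay distinct. *)
Lemma component_direct (s : seq (diff_group G)) (c : diff_group G -> K) :
    uniq s -> (forall d, d \in s -> component d (c d)) ->
    \sum_(d <- s) c d = 0 -> forall d, d \in s -> c d = 0.
Proof.
move=> us cs c0 d0 sd0; have [b [h [bh h0 hs]]] := common_denominator cs.
have Fh0 : h%:F != 0 by rewrite tofrac_neq0.
have /choice[p pP] d : exists p : G * R, d \in s ->
    [/\ R_ p.1 p.2, c d = p.2%:F / h%:F & c d != 0 -> d = diff p.1 b].
  have [/hs[->|[a [f [af cE dE]]]]|sd] := boolP (d \in s).
  - exists (0, 0) => _; split; first exact: (grading_0 grR).
      by rewrite rmorph0 mul0r.
    by rewrite eqxx.
  - by exists (a, f).
  - by exists 0.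
have [//|cd0] := eqVneq (c d0) 0.
(* only the nonzero coefficients have a numerator of a determined degree *)
pose s' := [seq d <- s | c d != 0].
have s'P d : d \in s' -> [/\ R_ (p d).1 (p d).2, c d = (p d).2%:F / h%:F
    & d = diff (p d).1 b].
  by rewrite mem_filter => /andP[cd /pP[Rp cE /(_ cd)]].
have sd0' : d0 \in s' by rewrite mem_filter cd0.
have p0 : \sum_(d <- s') (p d).2 = 0.
  apply: tofrac_inj; rewrite rmorph0 rmorph_sum /=.
  transitivity ((\sum_(d <- s) c d) * h%:F); last by rewrite c0 mul0r.
  rewrite mulr_suml big_filter [LHS]big_mkcond; apply: eq_big_seq => d sd /=.
  case: eqP => [->|/eqP cd]; first by rewrite mul0r.
  by have [|_ -> _] := s'P d; rewrite ?divfK // mem_filter cd.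
have Rp d : d \in s' -> R_ (p d).1 (p d).2 by case/s'P.
have := grading_coef grR Rp (grading_0 grR 0) p0 (p d0).1.
rewrite if_same -big_filter (@perm_big _ _ _ _ _ [:: d0]) ?big_seq1.
  by move=> pd0; have [_ -> _] := s'P _ sd0'; rewrite pd0 rmorph0 mul0r.
apply: uniq_perm; rewrite ?filter_uniq // => d; rewrite mem_filter inE.
apply/andP/eqP => [[/eqP E /s'P[_ _ ->]]|-> //].
by rewrite E; have [_ _ <-] := s'P _ sd0'.
Qed.

Lemma graded_quotient_field_grading :
  is_grading (graded_quotient_field R_) component.
Proof.
split.
- move=> d x [->|[a [b [f [g [af bg g0 -> _]]]]]]; last first.
    by exists f, g; split=> //; exists b.
  exists 0, 1; split; rewrite ?oner_neq0 ?rmorph0 ?mul0r //.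
  by exists 0; apply: grading_1.
- by move=> d; left.
- exact: component_B.
- move=> x [r [h [[b bh] h0 ->]]].
  have [s [c [us sc rE]]] := grading_sum grR (x := r) I.
  rewrite [r in r%:F]rE rmorph_sum mulr_suml.
  have [|||s' [c' [us' sc' E]]] := @sum_homogeneous_uniq _ _ component
      [seq (diff g b, (c g)%:F / h%:F) | g <- s].
  - by move=> d; left.
  - by move=> d y z dy dz; rewrite -[z]opprK; apply: component_B => //; apply: componentN.
  - by move=> _ /mapP[g sg ->] /=; right; exists g, b, (c g), h; split=> //; apply: sc.
  by exists s', c'; split=> //; rewrite -E big_map.
- exact: component_direct.
- exact: component_mul.
Qed.
End GradedQuotientField.

(** * Denominator ideals *)
Section ProductSpan.
Variable K : comNzRingType.
Implicit Types P Q I J : set K.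

Definition mulspan P Q : set K := [set x | exists2 s : seq (K * K),
  (forall p, p \in s -> P p.1 /\ Q p.2) & x = \sum_(p <- s) p.1 * p.2].

Lemma mulspan_gen P Q x y : P x -> Q y -> mulspan P Q (x * y).
Proof.
move=> Px Qy; exists [:: (x, y)]; last by rewrite big_seq1.
by move=> p; rewrite inE => /eqP->.
Qed.

Lemma mulspan0 P Q : mulspan P Q 0.
Proof. by exists [::] => //; rewrite big_nil. Qed.

Lemma mulspanD P Q x y : mulspan P Q x -> mulspan P Q y -> mulspan P Q (x + y).
Proof.
move=> [s Ps ->] [t Pt ->]; exists (s ++ t); last by rewrite big_cat.
by move=> p; rewrite mem_cat => /orP[/Ps|/Pt].
Qed.

Lemma mulspan_sum P Q (I : eqType) (t : seq I) (f : I -> K) :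
  (forall i, i \in t -> mulspan P Q (f i)) -> mulspan P Q (\sum_(i <- t) f i).
Proof.
by move=> Pf; rewrite big_seq; apply: big_ind => //;
  [exact: mulspan0 | exact: mulspanD].
Qed.

Lemma mulspanN P Q x : (forall a, P a -> P (- a)) ->
  mulspan P Q x -> mulspan P Q (- x).
Proof.
move=> PN [l Pl ->]; rewrite -sumrN; apply: mulspan_sum => p /Pl[Pp Qp].
by rewrite -mulNr; apply: mulspan_gen => //; apply: PN.
Qed.

Lemma mulspanM P Q P' Q' P'' Q'' x y :
    (forall a b, P a -> P' b -> P'' (a * b)) ->
    (forall a b, Q a -> Q' b -> Q'' (a * b)) ->
  mulspan P Q x -> mulspan P' Q' y -> mulspan P'' Q'' (x * y).
Proof.
move=> PP QQ [s Ps ->] [t Pt ->]; rewrite mulr_suml.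
apply: mulspan_sum => p /Ps[Pp Qp]; rewrite mulr_sumr.
apply: mulspan_sum => q /Pt[Pq Qq]; rewrite mulrACA.
by apply: mulspan_gen; [apply: PP | apply: QQ].
Qed.

Lemma mulspanS P Q P' Q' : P `<=` P' -> Q `<=` Q' ->
  mulspan P Q `<=` mulspan P' Q'.
Proof.
by move=> PP QQ _ [s Ps ->]; exists s => // p /Ps[/PP ? /QQ ?].
Qed.
End ProductSpan.

Section Denominators.
Variables (K : fieldType) (A B : subringClosed K).

Definition denominators (x : K) : set K := [set a | a \in A /\ a * x \in A].

(** For an ideal I of a subring of B this is I B = B. It makes sense for any
subset I, which spares the verification that the sets at hand are ideals. *)
Definition extends_to_unit (I : set K) : Prop :=
  mulspan I [set x | x \in B] 1.

Lemma extends_to_unitS (I J : set K) :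
  I `<=` J -> extends_to_unit I -> extends_to_unit J.
Proof. by move=> IJ; apply: mulspanS. Qed.

Lemma extends_to_unitM (I J L : set K) :
    (forall a b, I a -> J b -> L (a * b)) ->
  extends_to_unit I -> extends_to_unit J -> extends_to_unit L.
Proof.
move=> IJ I1 J1; rewrite /extends_to_unit -[1]mulr1.
by apply: mulspanM I1 J1 => // a b; apply: rpredM.
Qed.

Lemma extends_to_unitT : extends_to_unit [set a | a \in A].
Proof.
by rewrite /extends_to_unit -[1]mulr1; apply: mulspan_gen; apply: rpred1.
Qed.
End Denominators.

(** * Flatness of overrings *)
Section TensorGroup.
Variables (A : comNzRingType) (M N : lmodType A).

Definition tens (m : M) (n : N) : tensor M N := tensor_class [:: (m, n)].

Lemma tensor_class_cat (s t : seq (M * N)) :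
  tensor_class (s ++ t) = tensor_class s + tensor_class t.
Proof. exact/esym/tensor_addE. Qed.

Lemma tensor_classE (s : seq (M * N)) :
  tensor_class s = \sum_(p <- s) tens p.1 p.2.
Proof.
elim: s => [|[m n] s IH]; first by rewrite big_nil.
by rewrite big_cons -cat1s tensor_class_cat IH.
Qed.

Lemma tensDl m m' n : tens (m + m') n = tens m n + tens m' n.
Proof. by rewrite -tensor_class_cat; apply/tensor_classP/tensor_Dl. Qed.

Lemma tensDr m n n' : tens m (n + n') = tens m n + tens m n'.
Proof. by rewrite -tensor_class_cat; apply/tensor_classP/tensor_Dr. Qed.

Lemma tens0l n : tens 0 n = 0.
Proof. exact/tensor_classP/tensor_0l. Qed.

Lemma tens0r m : tens m 0 = 0.
Proof. by apply: (addrI (tens m 0)); rewrite -tensDr !addr0. Qed.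

Lemma tensZ a m n : tens (a *: m) n = tens m (a *: n).
Proof. exact/tensor_classP/tensor_Z. Qed.

Lemma tens_suml (I : Type) (t : seq I) (f : I -> M) n :
  tens (\sum_(i <- t) f i) n = \sum_(i <- t) tens (f i) n.
Proof.
by apply: (big_morph (tens^~ n)) => [m m'|]; [apply: tensDl | apply: tens0l].
Qed.

Lemma tens_sumr (I : Type) (t : seq I) (f : I -> N) m :
  tens m (\sum_(i <- t) f i) = \sum_(i <- t) tens m (f i).
Proof.
by apply: (big_morph (tens m)) => [n n'|]; [apply: tensDr | apply: tens0r].
Qed.
End TensorGroup.

Section FlatDenominators.
Variables (K : fieldType) (A B : subringClosed K) (sAB : {subset A <= B}).
Local Notation BA := (overring_module sAB).

(** The field as an A-module. The test map for the flatness of B is the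
inclusion of the submodule A + A b. *)
Definition field_module of (subringClosed K) : Type := K.
Local Notation KA := (field_module A).
HB.instance Definition _ := GRing.Zmodule.copy KA K.

Definition field_scale (a : subring_type A) (x : KA) : KA := val a * (x : K).

Fact field_scaleA a b x : field_scale a (field_scale b x) = field_scale (a * b) x.
Proof. exact: mulrA. Qed.
Fact field_scale1 : left_id 1 field_scale.
Proof. exact: mul1r. Qed.
Fact field_scaleDr : right_distributive field_scale +%R.
Proof. by move=> a x y; apply: mulrDr. Qed.
Fact field_scaleDl x : {morph field_scale^~ x : a b / a + b}.
Proof. by move=> a b; apply: mulrDl. Qed.

HB.instance Definition _ := GRing.Zmodule_isLmodule.Build (subring_type A) KA
  field_scaleA field_scale1 field_scaleDr field_scaleDl.

Variable b : K.

Definition adjoin_pred : {pred KA} :=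
  fun x => `[< exists2 y : K, y \in A & (x : K) - y * b \in A >].

Fact adjoin_submod_closed : submod_closed adjoin_pred.
Proof.
split=> [|a x y]; first by apply/asboolP; exists 0; rewrite ?rpred0 // mul0r subr0 rpred0.
move=> /asboolP[u Au xu] /asboolP[v Av yv]; apply/asboolP.
exists (val a * u + v); first by rewrite rpredD ?rpredM ?(valP a).
rewrite (_ : _ - _ = val a * ((x : K) - u * b) + ((y : K) - v * b)).
  by rewrite rpredD ?rpredM ?(valP a).
by rewrite mulrBr mulrDl mulrA opprD addrACA.
Qed.
HB.instance Definition _ := GRing.isSubmodClosed.Build (subring_type A) KA
  adjoin_pred adjoin_submod_closed.

Definition adjoin_module : Type := {x : KA | x \in adjoin_pred}.
HB.instance Definition _ := SubChoice.on adjoin_module.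
HB.instance Definition _ := [SubChoice_isSubLmodule of adjoin_module by <:].

(** Writing n in A + A b as n = x + y b with x, y in A determines y modulo the
ideal (A : b). Thus m (x) n |-> y m is a well-defined additive map from
B (x) (A + A b) to B / (A : b) B, here in terms of representatives. *)
Lemma tensor_cong_mod_denominators (y : adjoin_module -> K) :
    (forall n, y n \in A /\ (val n : K) - y n * b \in A) ->
  forall s t : seq (BA * adjoin_module), tensor_cong s t ->
    mulspan (denominators A b) [set x | x \in B]
      (\sum_(p <- s) y p.2 * val p.1 - \sum_(p <- t) y p.2 * val p.1).
Proof.
move=> yP; set J := mulspan _ _.
have JN x : J x -> J (- x).
  by apply: mulspanN => a [Aa ab]; split; rewrite ?mulNr rpredN.
move=> s t; elim=> {s t}.
- by move=> s; rewrite subrr; apply: mulspan0.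
- by move=> s t _ Jst; rewrite -opprB; apply: JN.
- move=> s t u _ Jst _ Jtu.
  by rewrite -(subrKA (\sum_(p <- t) y p.2 * val p.1)); apply: mulspanD.
- by move=> s s' t t' _ Js _ Jt; rewrite !big_cat opprD addrACA; apply: mulspanD.
- by move=> s t; rewrite !big_cat /= [X in X - _]addrC subrr; apply: mulspan0.
- by move=> n; rewrite big_seq1 big_nil mulr0 subrr; apply: mulspan0.
- move=> m m' n; rewrite !big_cons !big_nil /= !addr0 -mulrDr subrr.
  exact: mulspan0.
- move=> m n n'; rewrite !big_cons !big_nil /= !addr0 -mulrDl -mulrBl.
  apply: mulspan_gen; last exact: valP.
  have [[[An nb] [An' nb']] [Ann nnb]] := (yP n, yP n', yP (n + n')).
  split; first by rewrite rpredB // rpredD.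
  rewrite (_ : _ * b = ((val n : K) - y n * b) + ((val n' : K) - y n' * b)
    - ((val (n + n') : K) - y (n + n') * b)); first by rewrite rpredB // rpredD.
  rewrite (_ : (val (n + n') : K) = (val n : K) + (val n' : K)) //.
  by move: (val n : K) (val n' : K) (y n) (y n') (y (n + n')) => v v' u u' u''; ring.
- move=> a m n; rewrite !big_seq1 /= mulrCA mulrA -mulrBl.
  apply: mulspan_gen; last exact: valP.
  have [[An nb] [Aan anb]] := (yP n, yP (a *: n)).
  split; first by rewrite rpredB // rpredM // (valP a).
  rewrite (_ : _ * b = ((val (a *: n) : K) - y (a *: n) * b)
     - val a * ((val n : K) - y n * b)); first by rewrite rpredB // rpredM // (valP a).
  rewrite (_ : (val (a *: n) : K) = val a * (val n : K)) //.
  rewrite -[sval a]/(val a).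
  by move: (val a) (val n : K) (y n) (y (a *: n)) => k v u u'; ring.
Qed.

(** In B (x) K, with b = p / q, the elements b (x) 1 and 1 (x) b are both equal
to p (x) 1/q. By flatness they are already equal in B (x) (A + A b), and their
images in B / (A : b) B, where b (x) 1 goes to 0 and 1 (x) b to 1, agree: 1 is in (A : b) B. *)
Lemma flat_extends_denominators : flat BA -> b \in B -> quotient_field A b ->
  extends_to_unit B (denominators A b).
Proof.
move=> flatB Bb [p [q [Ap Aq q0 bE]]].
have adjoin1 : (1 : KA) \in adjoin_pred.
  by apply/asboolP; exists 0; rewrite ?rpred0 // mul0r subr0 rpred1.
have adjoinb : (b : KA) \in adjoin_pred.
  by apply/asboolP; exists 1; rewrite ?rpred1 // mul1r subrr rpred0.
pose n1 : adjoin_module := Sub (1 : KA) adjoin1.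
pose nb : adjoin_module := Sub (b : KA) adjoinb.
pose m1 : BA := 1 : subring_type B.
pose mb : BA := Sub b Bb.
have inj_val : injective (val : {linear adjoin_module -> KA}) by exact: val_inj.
have eqK : tens mb (1 : KA) = tens m1 (b : KA).
  pose q' : subring_type A := Sub q Aq.
  pose p' : subring_type A := Sub p Ap.
  have e1 : (1 : KA) = q' *: (q^-1 : KA) by rewrite /GRing.scale /= /field_scale /= mulfV.
  have e2 : q' *: mb = p' *: m1.
    by apply: val_inj; rewrite /= mulr1 bE mulrC divfK.
  rewrite e1 -tensZ e2 tensZ; congr tens.
  by rewrite [RHS]bE.
have := flatB _ _ _ inj_val (tens mb n1) (tens m1 nb).
rewrite /tens !tensor_mapE => /(_ eqK) /tensor_classP mb1.
have yP (n : adjoin_module) : exists y, y \in A /\ (val n : K) - y * b \in A.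
  by have /asboolP[y ? ?] := valP n; exists y.
have {}mb1 := tensor_cong_mod_denominators (fun n => svalP (cid (yP n))) mb1.
move: mb1; rewrite !big_seq1 /= mulr1.
case: (cid (yP n1)) (cid (yP nb)) => y1 /= [Ay1 y1b] [yb /= [Ayb ybb]].
move=> Jy; rewrite /extends_to_unit.
(* y1 and 1 - yb are in (A : b): the coefficients of b in 1 and in b are
   0 and 1 modulo this ideal *)
have -> : 1 = - (y1 * b - yb) + (y1 * b + (1 - yb) * 1) :> K by ring.
apply: mulspanD; last apply: mulspanD.
- by apply: mulspanN Jy => a [Aa ab]; split; rewrite ?mulNr rpredN.
- apply: mulspan_gen => //; split=> //.
  by rewrite -[y1 * b](subKr 1) rpredB ?rpred1.
- apply: mulspan_gen; last exact: rpred1.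
  by split; [rewrite rpredB ?rpred1 | rewrite mulrBl mul1r].
Qed.
End FlatDenominators.

Section DenominatorsFlat.
Variables (K : fieldType) (A B : subringClosed K) (sAB : {subset A <= B}).
Local Notation BA := (overring_module sAB).
Hypothesis extAB : forall x, x \in B -> extends_to_unit B (denominators A x).

(** For the converse, an element z of B (x) N is multiplied by an a in A that
clears the denominators of the left factors of z: then a z = 1 (x) n for an
explicit n in N. Two elements of B (x) N are equal exactly when these n agree
for a set of a's that extends to the unit ideal of B, and an injective map
N -> N' reflects this criterion. *)
Section Action.
Variable N : lmodType (subring_type A).
Implicit Types (n : N) (s t : seq (BA * N)).

(** The action of A on N, with arguments in K so that the product a m in K of an
a in A and an m in B can act whenever it lies in A; 0 outside A. *)
Definition act (x : K) n : N := (insubd 0 x : subring_type A) *: n.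

Lemma actE (a : subring_type A) n : act (val a) n = a *: n.
Proof. by rewrite /act valKd. Qed.

Lemma actDl x y n : x \in A -> y \in A -> act (x + y) n = act x n + act y n.
Proof.
move=> Ax Ay; rewrite -[x](SubK (subring_type A) Ax) -[y](SubK (subring_type A) Ay).
by rewrite -rmorphD !actE scalerDl.
Qed.

Lemma actM x y n : x \in A -> y \in A -> act (x * y) n = act x (act y n).
Proof.
move=> Ax Ay; rewrite -[x](SubK (subring_type A) Ax) -[y](SubK (subring_type A) Ay).
by rewrite -rmorphM !actE scalerA.
Qed.

Lemma act0l n : act 0 n = 0.
Proof. by apply: (addrI (act 0 n)); rewrite -actDl ?rpred0 // !addr0. Qed.

Lemma actDr x n n' : act x (n + n') = act x n + act x n'.
Proof. exact: scalerDr. Qed.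

Lemma act_sumr (I : Type) (t : seq I) (f : I -> N) x :
  act x (\sum_(i <- t) f i) = \sum_(i <- t) act x (f i).
Proof. exact: scaler_sumr. Qed.

Definition clears (a : K) s : Prop :=
  a \in A /\ forall p, p \in s -> a * val p.1 \in A.

(** If z is the class of s and a clears s, then a z = 1 (x) cleared a s. *)
Definition cleared (a : K) s : N := \sum_(p <- s) act (a * val p.1) p.2.

Lemma clears_cat a s t : clears a (s ++ t) <-> clears a s /\ clears a t.
Proof.
split=> [[Aa st]|[[Aa sA] [_ tA]]].
  by split; split=> // p sp; apply: st; rewrite mem_cat sp ?orbT.
by split=> // p; rewrite mem_cat => /orP[/sA|/tA].
Qed.

Lemma cleared_cat a s t : cleared a (s ++ t) = cleared a s + cleared a t.
Proof. exact: big_cat. Qed.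

Lemma clearsM a b s : a \in A -> clears b s -> clears (a * b) s.
Proof.
move=> Aa [Ab sA]; split=> [|p /sA]; first exact: rpredM.
by rewrite -mulrA; apply: rpredM.
Qed.

Lemma clearedM a b s : a \in A -> clears b s ->
  cleared (a * b) s = act a (cleared b s).
Proof.
move=> Aa [Ab sA]; rewrite /cleared act_sumr; apply: eq_big_seq => p sp.
by rewrite -mulrA actM // sA.
Qed.

Lemma extends_clears s : extends_to_unit B (clears^~ s).
Proof.
elim: s => [|p s IH].
  by apply: extends_to_unitS (extends_to_unitT A B) => a Aa; split.
apply: extends_to_unitM IH (extAB (valP p.1)) => a b [Aa sA] [Ab pA].
split=> [|q]; first exact: rpredM.
rewrite inE => /predU1P[->|/sA sq]; first by rewrite -mulrA rpredM.
by rewrite mulrAC rpredM.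
Qed.

(** A chain of elementary congruences needs a product of finitely many sets of
multipliers, one for each link. *)
Lemma tensor_cong_cleared s t : tensor_cong s t ->
  extends_to_unit B
    [set a | [/\ clears a s, clears a t & cleared a s = cleared a t]].
Proof.
have simple s' t' : (forall a, clears a s' -> clears a t' -> cleared a s' = cleared a t') ->
    extends_to_unit B
      [set a | [/\ clears a s', clears a t' & cleared a s' = cleared a t']].
  move=> E; apply: extends_to_unitS (extends_clears (s' ++ t')) => a.
  by move=> /clears_cat[sa ta]; split=> //; apply: E.
elim=> {s t}.
- by move=> s; apply: simple.
- by move=> s t _; apply: extends_to_unitS => a [? ? ?]; split.
- move=> s t u _ Ist _ Itu; apply: extends_to_unitM Ist Itu => a b.
  move=> [sa ta stE] [tb ub tuE].
  have [Aa Ab] : a \in A /\ b \in A by case: sa tb => [? _] [].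
  split; [by rewrite mulrC; apply: clearsM | exact: clearsM |].
  rewrite mulrC (clearedM Ab sa) stE -(clearedM Ab ta).
  by rewrite mulrC (clearedM Aa tb) tuE -(clearedM Aa ub).
- move=> s s' t t' _ Is _ It; apply: extends_to_unitM Is It => a b.
  move=> [sa sa' sE] [tb tb' tE].
  have [Aa Ab] : a \in A /\ b \in A by case: sa tb => [? _] [].
  split.
  + by apply/clears_cat; split; [rewrite mulrC|]; apply: clearsM.
  + by apply/clears_cat; split; [rewrite mulrC|]; apply: clearsM.
  + rewrite !cleared_cat !(clearedM _ tb, clearedM _ tb') //.
    by rewrite mulrC !(clearedM _ sa, clearedM _ sa') // sE tE.
- by move=> s t; apply: simple => a _ _; rewrite !cleared_cat addrC.
- move=> n; apply: simple => a _ _.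
  by rewrite /cleared big_seq1 big_nil mulr0 act0l.
- move=> m m' n; apply: simple => a _ [_ sA].
  rewrite /cleared !big_cons !big_nil !addr0 /= mulrDr actDl //.
    exact: (sA (m, n) (mem_head _ _)).
  by apply: (sA (m', n)); rewrite !inE eqxx orbT.
- move=> m n n'; apply: simple => a _ _.
  by rewrite /cleared !big_cons !big_nil !addr0 /= actDr.
- move=> c m n; apply: simple => a _ [_ sA].
  rewrite /cleared !big_seq1 /= mulrCA mulrC actM ?actE ?(valP c) //.
  exact: (sA (m, c *: n) (mem_head _ _)).
Qed.

(** If 1 is the sum of the a_k t_k with t_k in B, every z is the sum of the
t_k (a_k z), where a_k z = 1 (x) n_k depends only on the cleared sum n_k. *)
Lemma tensor_eq_cleared s t :
    extends_to_unit B
      [set a | [/\ clears a s, clears a t & cleared a s = cleared a t]] ->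
  tensor_class s = tensor_class t.
Proof.
move=> [l lP l1].
pose f (x : K) : BA := insubd (0 : subring_type B) x.
have tensorE u : (forall p, p \in l -> clears p.1 u) ->
    tensor_class u = \sum_(p <- l) tens (f p.2) (cleared p.1 u).
  move=> lu; under eq_bigr do rewrite tens_sumr.
  rewrite exchange_big tensor_classE; apply: eq_big_seq => -[m n] umn /=.
  under eq_bigr do rewrite -tensZ.
  rewrite -tens_suml; congr tens; apply: val_inj.
  rewrite (raddf_sum (val : subring_type B -> K)) /= -[LHS]mul1r l1 mulr_suml.
  apply: eq_big_seq => p lp; have [_ /(_ _ umn) Apm] := lu _ lp.
  have [_ Bp] := lP _ lp.
  by rewrite -[sval _]/(val _) !insubdK // mulrAC.
rewrite !tensorE => [|p /lP[[]]//|p /lP[[]]//].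
by apply: eq_big_seq => p /lP[[_ _ ->]].
Qed.
End Action.

Lemma denominators_flat : flat BA.
Proof.
move=> N N' f inj_f; elim/tensor_ind=> s; elim/tensor_ind=> t.
rewrite !tensor_mapE => /tensor_classP /tensor_cong_cleared I1.
apply: tensor_eq_cleared; apply: extends_to_unitS I1 => a.
have clearsf u : clears a [seq (p.1, f p.2) | p <- u] -> clears a u.
  by move=> [Aa uA]; split=> // p /(map_f (fun p => (p.1, f p.2))) /uA.
have clearedf u : cleared a [seq (p.1, f p.2) | p <- u] = f (cleared a u).
  by rewrite /cleared big_map linear_sum; apply: eq_bigr => p _; exact/esym/linearZ.
by move=> [/clearsf sa /clearsf ta]; rewrite !clearedf => /inj_f.
Qed.
End DenominatorsFlat.

(** * The overring of R generated by an overring of its component of degree 0 *)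
Section Extension.
Variables (G : nmodType) (cG : cancellative G).
Variables (R : idomainType) (R_ : G -> set R) (grR : is_grading setT R_).
Local Notation K := {fraction R}.
Local Notation component := (graded_quotient_field_component R_).
Local Notation A := (deg0 cG grR).
Variable B : subringClosed K.

Definition extension_component (g : G) : set K :=
  mulspan [set x | x \in B] [set x | exists2 r : R, R_ g r & x = r%:F].

Definition extension_pred : {pred K} :=
  fun x => `[< mulspan [set x | x \in B] [set x | x \in domain R] x >].

Fact extension_subring_closed : subring_closed extension_pred.
Proof.
split=> [|x y /asboolP Tx /asboolP Ty|x y /asboolP Tx /asboolP Ty]; apply/asboolP.
- by rewrite -[1]mulr1; apply: mulspan_gen; apply: rpred1.
- by apply: mulspanD => //; apply: mulspanN Ty => a /=; rewrite rpredN.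
- by apply: mulspanM Tx Ty => a b; apply: rpredM.
Qed.
HB.instance Definition _ := GRing.isSubringClosed.Build K extension_pred
  extension_subring_closed.

Definition extension : subringClosed K := extension_pred.

Lemma extensionP x : x \in extension <->
  mulspan [set x | x \in B] [set x | x \in domain R] x.
Proof. by split=> [/asboolP|?] //; apply/asboolP. Qed.

Hypothesis overB : overring A B.

Lemma deg0P x : x \in A <-> exists2 r : R, R_ 0 r & x = r%:F.
Proof. by split=> [/asboolP|?] //; apply/asboolP. Qed.

Lemma domainP x : x \in domain R <-> exists r : R, x = r%:F.
Proof. by split=> [/asboolP|?] //; apply/asboolP. Qed.

Lemma overring_fraction x : x \in B ->
  exists p q : R, [/\ R_ 0 p, R_ 0 q, q != 0 & x = p%:F / q%:F].
Proof.
move=> /(proj2 overB)[_ [_ [/deg0P[p p0 ->] /deg0P[q q0 ->] qn0 ->]]].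
by exists p, q; rewrite tofrac_neq0 in qn0.
Qed.

Lemma sub_overring_extension x : x \in B -> x \in extension.
Proof.
move=> Bx; apply/extensionP; rewrite -[x]mulr1.
by apply: mulspan_gen => //; apply: rpred1.
Qed.

Lemma sub_domain_extension : {subset domain R <= extension}.
Proof.
move=> x Rx; apply/extensionP; rewrite -[x]mul1r.
by apply: mulspan_gen => //; apply: rpred1.
Qed.

(** The elements of B are fractions of elements of degree 0, so multiplication
by them preserves degrees. *)
Lemma extension_component_sub g x :
  extension_component g x -> component (diff g 0) x.
Proof.
have grK := graded_quotient_field_grading cG grR.
move=> [s sP ->]; apply: (grading_bigsum grK) => -[b y] /sP[/= Bb [r gr ->]] _.
have [p [q [p0 q0 qn0 ->]]] := overring_fraction Bb.
right; exists (0 + g), 0, (p * r), q; split=> //.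
- exact: (grading_mul grR).
- by rewrite rmorphM mulrAC.
- by rewrite add0r.
Qed.

Lemma extension_component0 x : extension_component 0 x -> x \in B.
Proof.
move=> [s sP ->]; rewrite big_seq; apply: rpred_sum => p /sP[/= Bp [r r0 ->]].
by apply: rpredM => //; apply: (proj1 overB); apply/deg0P; exists r.
Qed.

Lemma extension_sum x : x \in extension ->
  exists2 t : seq (G * K), forall p, p \in t -> extension_component p.1 p.2 &
    x = \sum_(p <- t) p.2.
Proof.
move=> /extensionP[s]; elim: s x => [|[b y] s IH] x sP ->.
  by exists [::]; rewrite ?big_nil.
have [|t tP tE] := IH _ _ (erefl _); first by move=> p sp; apply: sP; rewrite inE sp orbT.
have [/= Bb /domainP[r ->]] := sP _ (mem_head _ _).
have [u [c [uu uc rE]]] := grading_sum grR (x := r) I.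
exists ([seq (g, b * (c g)%:F) | g <- u] ++ t).
  move=> p; rewrite mem_cat => /orP[/mapP[g ug ->]|/tP//].
  by apply: mulspan_gen => //; exists (c g) => //; apply: uc.
by rewrite big_cons big_cat big_map /= -tE {1}rE rmorph_sum mulr_sumr.
Qed.

Lemma diff0_inj : injective (fun g : G => diff g 0).
Proof. by move=> g h /diff_cancel; rewrite !addr0; apply. Qed.

Lemma extension_grading :
  is_grading [set x | x \in extension] extension_component.
Proof.
apply: (is_grading_sub diff0_inj (graded_quotient_field_grading cG grR)).
- by move=> g x /extension_component_sub.
- move=> g x; rewrite /= extensionP; apply: mulspanS => // y [r _ ->] /=.
  by apply/domainP; exists r.
- by move=> g; apply: mulspan0.
- move=> g x y gx gy; apply: mulspanD => //; apply: mulspanN gy => a /=.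
  by rewrite rpredN.
- move=> g h x y; apply: mulspanM => a b /=; first exact: rpredM.
  move=> [r gr ->] [r' gr' ->]; exists (r * r'); last by rewrite rmorphM.
  exact: (grading_mul grR).
- exact: extension_sum.
Qed.

Lemma extension_graded_overring : graded_overring R_ extension.
Proof.
have grK := graded_quotient_field_grading cG grR.
have TK g x : extension_component g x ->
    ([set x | x \in extension] `&` component (diff g 0)) x.
  move=> gx; split; first exact: (grading_sub extension_grading) gx.
  exact: extension_component_sub.
split; first exact: sub_domain_extension.
- move=> x /extension_sum[t tP ->]; rewrite big_seq.
  apply: big_ind => [||p /tP/extension_component_sub].
  + exact: (grading_sub grK (grading_0 grK 0)).
  + exact: (graded_quotient_fieldD grR).
  + by move=> /(grading_sub grK).
- apply: (is_grading_sub (phi := id) _ grK) => //.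
  + by move=> d; split; [exact: rpred0 | exact: (grading_0 grK)].
  + move=> d x y [Tx dx] [Ty dy].
    by split; [exact: rpredB | exact: (grading_B grK)].
  + move=> d e x y [Tx dx] [Ty dy].
    by split; [exact: rpredM | exact: (grading_mul grK)].
  + move=> x /extension_sum[t tP ->].
    exists [seq (diff p.1 0, p.2) | p <- t]; last by rewrite big_map.
    by move=> _ /mapP[p /tP/TK ? ->].
Qed.

(** If a is in (A : b) and c z is in R, then a c (b y + z) is in R for y in R:
the denominators of a sum of products b y contain the product of the ideals
(A : b). *)
Lemma extension_denominators :
    (forall b, b \in B -> extends_to_unit B (denominators A b)) ->
  forall x, x \in extension -> extends_to_unit extension (denominators (domain R) x).
Proof.
move=> extB x /extensionP[s sP ->].
elim: s sP => [|[b y] s IH] sP.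
  rewrite big_nil; apply: extends_to_unitS (extends_to_unitT (domain R) _) => a Ra.
  by split; rewrite ?mulr0 ?rpred0.
have [/= Bb Ry] := sP _ (mem_head _ _).
rewrite big_cons; have {}IH := IH (fun p sp => sP p (mem_behead (s := _ :: s) sp)).
have extb : extends_to_unit extension (denominators A b).
  by apply: mulspanS (extB b Bb) => // z /sub_overring_extension.
have AR z : z \in A -> z \in domain R.
  by move=> /deg0P[r _ ->]; apply/domainP; exists r.
apply: extends_to_unitM extb IH => a c [/AR Ra /AR ab] [Rc cs] /=.
split; first exact: rpredM.
rewrite mulrDr rpredD //; last by rewrite -mulrA rpredM.
by rewrite mulrACA; apply: rpredM => //; apply: rpredM.
Qed.

(** If r q = p with p and q of degree 0 and q != 0, comparing the components of
degree 0 shows that the component of degree 0 of r has the same product with q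
as r itself. *)
Lemma domain_overring_deg0 x : x \in B -> x \in domain R -> x \in A.
Proof.
move=> Bx /domainP[r xr]; rewrite {}xr in Bx *; apply/deg0P; exists r => //.
have [p [q [p0 q0 qn0 rE]]] := overring_fraction Bx.
have {}rE : r * q = p.
  by apply: tofrac_inj; rewrite rmorphM /= rE divfK // tofrac_neq0.
have [s [c [us sc E]]] := grading_sum grR (x := r) I.
have scq g : g \in s -> R_ g (c g * q).
  by move=> /sc gc; have := grading_mul grR gc q0; rewrite addr0.
have rqE : \sum_(g <- s) c g * q = p by rewrite -rE [in RHS]E mulr_suml.
have := grading_coef grR (d := id) scq p0 rqE 0.
rewrite eqxx -rE -mulr_suml => /(mulIf qn0) <-.
by apply: (grading_bigsum grR) => g /sc gc /eqP <-.
Qed.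
End Extension.

(** The elements of W are units of the extension, hence of degree 0, and so are
their inverses; the numerators then have degree 0 as well. *)
Lemma localization_deg0_of_extension (G : nmodType) (cG : cancellative G)
    (tG : torsion_free G) (uG : trivial_units G)
    (R : idomainType) (R_ : G -> set R) (grR : is_grading setT R_)
    (B : subringClosed {fraction R}) :
  overring (deg0 cG grR) B -> localization (domain R) (extension B) ->
  localization (deg0 cG grR) B.
Proof.
move=> overB [W [WR W1 W0 WM] TE].
have grT := extension_grading overB.
have T1 : extension_component R_ B 0 1.
  rewrite -[1]mulr1; apply: mulspan_gen; first exact: rpred1.
  by exists 1; [apply: grading_1 | rewrite rmorph1].
have unitB x y : x \in extension B -> y \in extension B -> x * y = 1 -> x \in B.
  move=> Tx Ty xy1; apply: (extension_component0 overB).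
  exact: (unit_degree0 cG tG uG grT T1 Tx Ty xy1).
have W0' w : W w -> w != 0 by move=> Ww; apply: contra_notN W0 => /eqP <-.
have WB w : W w -> w \in B /\ w^-1 \in B.
  move=> Ww; have Tw : w \in extension B by apply/sub_domain_extension/WR.
  have Tw' : w^-1 \in extension B.
    by apply/TE; exists 1, w; rewrite rpred1 mul1r.
  by split; [apply: (unitB w w^-1) | apply: (unitB w^-1 w)] => //;
    rewrite ?mulfV ?mulVf // W0'.
have WA w : W w -> w \in deg0 cG grR.
  by move=> Ww; apply: (domain_overring_deg0 overB); [case: (WB w Ww) | exact: WR].
exists W; first by split.
move=> x; split=> [Bx|[a [w [Aa Ww ->]]]]; last first.
  by apply: rpredM; [exact: (proj1 overB) | case: (WB w Ww)].
have /TE[a [w [Ra Ww xE]]] := sub_overring_extension Bx.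
exists a, w; split=> //; apply: (domain_overring_deg0 overB) => //.
have -> : a = x * w by rewrite xE divfK // W0'.
by apply: rpredM => //; case: (WB w Ww).
Qed.

Theorem proposition2p31 (G : nmodType) (cG : cancellative G)
    (tG : torsion_free G) (uG : trivial_units G)
    (R : idomainType) (R_ : G -> set R) (grR : is_grading setT R_) :
  (forall T : subringClosed {fraction R},
     graded_overring R_ T -> flat_over (domain R) T ->
     localization (domain R) T) ->
  forall B : subringClosed {fraction R},
    overring (deg0 cG grR) B -> flat_over (deg0 cG grR) B ->
    localization (deg0 cG grR) B.
Proof.
move=> locT B overB [sAB flatB].
apply: localization_deg0_of_extension => //; apply: locT.
  exact: extension_graded_overring overB.
exists (sub_domain_extension B); apply: denominators_flat => x.
apply: (extension_denominators (cG := cG) (grR := grR)) => b Bb.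
exact: (flat_extends_denominators flatB Bb (proj2 overB b Bb)).
Qed.
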